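(* Let $e \ge 10$ and $n \in \{2,\ldots,e-2\}$. Then a minimal generating set of the ideal $I_{S(e,1,n)}$ is $G_{S(e,1,n)} = J_n \cup K_n \cup L_{e,n}$, where $J_n$ is the set of all $2\times 2$ minors of the matrix $A_n$, $K_n$ is the set of all $2\times 2$ minors of the matrix $B_n$ that involve its first column ($A_n$, $B_n$ are defined in the context), and $L_{e,n}$ is given by: (1) $L_{e,2}=\emptyset$. (2) $L_{e,3}=\{x_4x_{4+i}-x_2x_{6+i} \mid 0\le i\le e-7\}\cup\{x_0^2x_2-x_4x_{e-2}\}$. (3) $L_{e,4}=\{x_5x_{5+i}-x_3x_{7+i}\mid 0\le i\le e-8\}\cup\{x_3^2-x_0x_6\}\cup\{x_0^2x_3-x_5x_{e-2},\ x_0x_2^2-x_5x_{e-1},\ x_2^3-x_7x_{e-1}\}$. (4) For $5\le n\le e-4$: $L_{e,n}=\{x_{n+1}x_{n+1+i}-x_{n-1}x_{n+3+i}\mid 0\le i\le e-n-4\}\cup\{x_{n-1}x_{n-1-i}-x_{n+1}x_{n-3-i}\mid 0\le i\le n-5\}\cup\{x_{n-1}x_3-x_{n+2}x_0\}\cup\{x_0^2x_{n-1}-x_{n+1}x_{e-2},\ x_0x_2x_{n-2}-x_{n+1}x_{e-1}\}$. (5) $L_{e,e-3}=\{x_{e-4}x_{e-4-i}-x_{e-2}x_{e-6-i}\mid 0\le i\le e-8\}\cup\{x_{e-4}x_3-x_0x_{e-1}\}\cup\{x_0^2x_{e-4}-x_{e-2}^2,\ x_0x_2x_{e-5}-x_{e-2}x_{e-1}\}$.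 (6) $L_{e,e-2}=\{x_{e-3}x_{e-3-i}-x_{e-1}x_{e-5-i}\mid 0\le i\le e-7\}\cup\{x_0^3-x_3x_{e-3},\ x_0x_2x_{e-4}-x_{e-1}^2\}$.
   Context: $\mathbb K$ is an algebraically closed field of characteristic zero. For $1\le m<n\le e-2$, $S(e,m,n)$ is the numerical semigroup generated by $\{e,e+1,\ldots,2e-1\}\setminus\{e+m,e+n\}$. Let $R(e,m,n)=\mathbb K[\{x_0,\ldots,x_{e-1}\}\setminus\{x_m,x_n\}]$. The defining ideal $I_{S(e,m,n)}\subseteq R(e,m,n)$ is the kernel of the $\mathbb K$-algebra homomorphism $R(e,m,n)\to\mathbb K[t]$, $x_i\mapsto t^{e+i}$. The matrices (two rows each) are as follows; an index range whose lower bound exceeds its upper bound is empty. $A_n$ ($2\le n\le e-2$) has, in this order, columns $\begin{bmatrix} x_i \\ x_{i+1} \end{bmatrix}$ for $2\le i\le n-2$, then $\begin{bmatrix} x_i \\ x_{i+1} \end{bmatrix}$ for $n+1\le i\le e-2$, then $\begin{bmatrix} x_{e-1} \\ x_0^2 \end{bmatrix}$. $B_2$ has first column $\begin{bmatrix} x_0 \\ x_3 \end{bmatrix}$, then columns $\begin{bmatrix} x_i \\ x_{i+3} \end{bmatrix}$ for $3\le i\le e-4$, then $\begin{bmatrix} x_{e-3} \\ x_0^2 \end{bmatrix}$. For $n\ge 3$, $B_n$ has first column $\begin{bmatrix} x_0 \\ x_2 \end{bmatrix}$, then columns $\begin{bmatrix} x_i \\ x_{i+2} \end{bmatrix}$ for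 $2\le i\le n-3$, then $\begin{bmatrix} x_{n-1} \\ x_{n+1} \end{bmatrix}$, then $\begin{bmatrix} x_i \\ x_{i+2} \end{bmatrix}$ for $n+1\le i\le e-3$, and finally, if $n\ne e-2$, the column $\begin{bmatrix} x_{e-2} \\ x_0^2 \end{bmatrix}$ (for $n=e-2$ the last column is $\begin{bmatrix} x_{e-3} \\ x_{e-1} \end{bmatrix}$). *)

(* Defs.v *)
From mathcomp Require Import all_boot all_order all_algebra.
From mathcomp Require Import boolp classical_sets.
From mathcomp Require Import mpoly.

Set Implicit Arguments.
Unset Strict Implicit.
Unset Printing Implicit Defensive.

Import GRing.Theory.

Local Open Scope classical_set_scope.
Local Open Scope ring_scope.

Section Ideals.
Variable R : comNzRingType.

Definition ideal_span (G : set R) : set R :=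
  [set p | exists2 s : seq (R * R),
     forall ag, ag \in s -> G ag.2 & p = \sum_(ag <- s) ag.1 * ag.2].

Definition minimal_generating_set (I G : set R) : Prop :=
  ideal_span G = I /\ forall H : set R, H `<=` G -> ideal_span H = I -> H = G.

End Ideals.

Section Minors.
Variable R : comNzRingType.

(* The two-row matrix whose columns are the pairs (top entry, bottom entry). *)
Definition mx_of_cols (s : seq (R * R)) : 'M[R]_(2, size s) :=
  \matrix_(r, j) (let c := nth (0, 0) s j in if r == 0 then c.1 else c.2).

Definition minor2 k (M : 'M[R]_(2, k)) (i j : 'I_k) : R :=
  \det (\matrix_(r < 2, c < 2) M r (if c == 0 then i else j)).

(* Columns are taken in increasing order, which fixes the sign of each minor. *)
Definition minors2 k (M : 'M[R]_(2, k)) : set R :=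
  [set p | exists i j : 'I_k, (i < j)%N /\ p = minor2 M i j].

Definition minors2_first_col k (M : 'M[R]_(2, k)) : set R :=
  [set p | exists i j : 'I_k,
     [/\ (i < j)%N, i = 0%N :> nat & p = minor2 M i j]].

End Minors.

Section SemigroupIdeal.
Variables (k : fieldType) (e m n : nat).

Definition index := {i : 'I_e | (i != m :> nat) && (i != n :> nat)}.

(* k[{x_0, ..., x_(e-1)} \ {x_m, x_n}]: the indeterminates, indexed by [index],
   are numbered by [enum_rank]. *)
Definition Rg : comNzRingType := {mpoly k[#|{: index}|]}.

(* The indeterminate x_i; the value 0 when i is not an element of [index] is
   never used below. *)
Definition xvar (i : nat) : Rg :=
  if [pick j : index | val (val j) == i] is Some j
  then 'X_(enum_rank j) else 0.

Definition phi (p : Rg) : {poly k} :=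
  mmap (@polyC k) (fun j => 'X^(e + val (val (enum_val j : index)))) p.

Definition I_S : set Rg := [set p | phi p = 0].

End SemigroupIdeal.

Arguments I_S k e m n : clear implicits.

Section Generators.
Variables (k : fieldType) (e n : nat).

Local Notation x := (xvar k e 1 n).
Local Notation R := (Rg k e 1 n).

Definition A_cols : seq (R * R) :=
  [seq (x i, x i.+1) | i <- index_iota 2 n.-1]
  ++ [seq (x i, x i.+1) | i <- index_iota n.+1 e.-1]
  ++ [:: (x e.-1, x 0 ^+ 2)].

Definition B_cols : seq (R * R) :=
  if n == 2%N then
    (x 0, x 3) :: [seq (x i, x (i + 3)) | i <- index_iota 3 (e - 3)]
    ++ [:: (x (e - 3), x 0 ^+ 2)]
  else
    (x 0, x 2) :: [seq (x i, x (i + 2)) | i <- index_iota 2 (n - 2)]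
    ++ (x (n - 1), x (n + 1))
      :: [seq (x i, x (i + 2)) | i <- index_iota n.+1 (e - 2)]
    ++ (if n == (e - 2)%N then [::] else [:: (x (e - 2), x 0 ^+ 2)]).

Definition J : set R := minors2 (mx_of_cols A_cols).

Definition K : set R := minors2_first_col (mx_of_cols B_cols).

Definition L3 : set R :=
  [set x 4 * x (4 + i) - x 2 * x (6 + i) | i in [set i | (i <= e - 7)%N]]
  `|` [set x 0 ^+ 2 * x 2 - x 4 * x (e - 2)].

Definition L4 : set R :=
  [set x 5 * x (5 + i) - x 3 * x (7 + i) | i in [set i | (i <= e - 8)%N]]
  `|` [set x 3 ^+ 2 - x 0 * x 6]
  `|` [set x 0 ^+ 2 * x 3 - x 5 * x (e - 2);
           x 0 * x 2 ^+ 2 - x 5 * x (e - 1);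
           x 2 ^+ 3 - x 7 * x (e - 1)].

Definition L_mid : set R :=
  [set x (n + 1) * x (n + 1 + i) - x (n - 1) * x (n + 3 + i)
     | i in [set i | (i <= e - n - 4)%N]]
  `|` [set x (n - 1) * x (n - 1 - i) - x (n + 1) * x (n - 3 - i)
     | i in [set i | (i <= n - 5)%N]]
  `|` [set x (n - 1) * x 3 - x (n + 2) * x 0]
  `|` [set x 0 ^+ 2 * x (n - 1) - x (n + 1) * x (e - 2);
           x 0 * x 2 * x (n - 2) - x (n + 1) * x (e - 1)].

Definition L_e3 : set R :=
  [set x (e - 4) * x (e - 4 - i) - x (e - 2) * x (e - 6 - i)
     | i in [set i | (i <= e - 8)%N]]
  `|` [set x (e - 4) * x 3 - x 0 * x (e - 1)]
  `|` [set x 0 ^+ 2 * x (e - 4) - x (e - 2) ^+ 2;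
           x 0 * x 2 * x (e - 5) - x (e - 2) * x (e - 1)].

Definition L_e2 : set R :=
  [set x (e - 3) * x (e - 3 - i) - x (e - 1) * x (e - 5 - i)
     | i in [set i | (i <= e - 7)%N]]
  `|` [set x 0 ^+ 3 - x 3 * x (e - 3);
           x 0 * x 2 * x (e - 4) - x (e - 1) ^+ 2].

(* For e >= 10 the tests below are pairwise exclusive, and the last branch is
   5 <= n <= e - 4. *)
Definition L : set R :=
  if n == 2%N then set0
  else if n == 3%N then L3
  else if n == 4%N then L4
  else if n == (e - 3)%N then L_e3
  else if n == (e - 2)%N then L_e2
  else L_mid.

Definition G_S : set R := J `|` K `|` L.

End Generators.

Arguments G_S k e n : clear implicits.

(* Main.v *)
From HB Require Import structures.
Require Import Defs.
From mathcomp Require Import all_boot all_order all_algebra.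
From mathcomp Require Import boolp classical_sets mpoly zify ring.

(** Give [x_i] the degree [e + i]; the defining ideal is then spanned by the
    differences of monomials of equal degree.  A monomial of degree [2 e + s]
    with [s <= 2 e - 2] is a product [x_a x_(s - a)], or, when [s = e + t], a
    product of three variables whose indices add up to [t].  List the products
    of two variables by increasing smaller index [a], and put the products of
    three variables before them; this respects smallest indices, because
    [s - a <= e - 1] forces [a > t].

    The given generators are, up to sign, the differences of neighbours in these
    lists.  The minors of [A_n] are the steps from [a] to [a + 1] and, through its
    last column, most steps from the products of three variables to the first
    pair; the minors of [B_n] are the steps that leave [x_0] or [x_0 ^ 3], and
    [L_(e,n)] supplies the steps that both matrices lose because [x_n] is
    missing.  There is one exception: for [n = 4] the monomial [x_2 ^ 3] shares
    no variable with the other monomials of its degree and needs a link of its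
    own.  This description is [G_linkE]; the rest of the proof uses only it.

    The generators span the ideal.  Walking along the lists shows that products
    of two variables with the same degree are congruent ([quad_congr]), also to
    a product of three variables if there is one ([cubic_congr]).  Now consider
    the products of a power of [x_0] with one of [e] fixed monomials, the least
    ones in their residue classes modulo [e].  Multiplying such a product by a
    variable gives a monomial that is again congruent to one of this shape
    ([reduces_step]).  So each monomial has a normal form that depends only on its
    degree ([reducesX]), and a polynomial in the kernel of [phi], whose
    coefficients add up to zero in each degree, is congruent to zero
    ([ideal_span_G]).

    No generator can be omitted.  For the step to the pair [b] in degree
    [2 e + s], add up the coefficients of the monomials of that degree that come
    before [b].  This functional is [1] or [-1] on the step itself and vanishes
    on the other steps, whose two terms lie on the same side of [b].  It vanishes
    on proper multiples of steps as well, since their terms have at least three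
    variables and come before all pairs ([cut_shift]).  The two links of degree
    [3 e + 6] for [n = 4] are told apart by the coefficient of [x_2 ^ 3]. *)

Set Implicit Arguments.
Unset Strict Implicit.
Unset Printing Implicit Defensive.

Import GRing.Theory.

Local Open Scope classical_set_scope.
Local Open Scope ring_scope.

(** * Ideals spanned by a set *)

Section IdealSpan.
Variable R : comNzRingType.
Implicit Types (G H : set R) (p q r : R).

Lemma ideal_span_gen G p : G p -> ideal_span G p.
Proof.
move=> Gp; exists [:: (1, p)]; first by move=> ag; rewrite inE => /eqP->.
by rewrite big_seq1 mul1r.
Qed.

Lemma ideal_span0 G : ideal_span G 0.
Proof. by exists [::] => //; rewrite big_nil. Qed.

Lemma ideal_spanD G p q :
  ideal_span G p -> ideal_span G q -> ideal_span G (p + q).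
Proof.
move=> [s sG ->] [t tG ->]; exists (s ++ t); last by rewrite big_cat.
by move=> ag; rewrite mem_cat => /orP[/sG|/tG].
Qed.

Lemma ideal_spanM G p q : ideal_span G q -> ideal_span G (p * q).
Proof.
move=> [s sG ->]; exists [seq (p * ag.1, ag.2) | ag <- s].
  by move=> _ /mapP[ag /sG agG ->].
by rewrite big_map big_distrr /=; apply: eq_bigr => ag _; rewrite mulrA.
Qed.

Lemma ideal_span_min G (I : set R) :
    I 0 -> (forall p q, I p -> I q -> I (p + q)) ->
    (forall p q, I q -> I (p * q)) -> G `<=` I ->
  ideal_span G `<=` I.
Proof.
move=> I0 ID IM GI p [s sG ->]; rewrite big_seq.
by elim/big_ind: _ => // ag /sG/GI; apply: IM.
Qed.

Definition congr_mod G p q := ideal_span G (p - q).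

Lemma congr_refl G p : congr_mod G p p.
Proof. by rewrite /congr_mod subrr; apply: ideal_span0. Qed.

Lemma congr_sym G p q : congr_mod G p q -> congr_mod G q p.
Proof. by move=> /(ideal_spanM (-1)); rewrite mulN1r opprB. Qed.

Lemma congr_trans G q p r :
  congr_mod G p q -> congr_mod G q r -> congr_mod G p r.
Proof. by move=> pq /(ideal_spanD pq); rewrite addrA subrK. Qed.

Lemma congrMl G p q r : congr_mod G p q -> congr_mod G (r * p) (r * q).
Proof. by rewrite /congr_mod -mulrBr; apply: ideal_spanM. Qed.

Lemma congrMr G p q r : congr_mod G p q -> congr_mod G (p * r) (q * r).
Proof. by rewrite ![_ * r]mulrC; apply: congrMl. Qed.

Lemma congr_sum G (I : eqType) (s : seq I) (F1 F2 : I -> R) :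
    (forall i, i \in s -> congr_mod G (F1 i) (F2 i)) ->
  congr_mod G (\sum_(i <- s) F1 i) (\sum_(i <- s) F2 i).
Proof.
move=> F12; rewrite /congr_mod -sumrB big_seq.
by elim/big_ind: _ => [|p q|i /F12 //]; [exact: ideal_span0|exact: ideal_spanD].
Qed.

(** The functional [l] vanishes on the ideal spanned by the generators other
    than [g] but not at [g], so no subset that omits [g] spans [I]. *)
Lemma minimal_generating_setP (V : zmodType) (I G : set R) :
    ideal_span G = I ->
    (forall g, G g -> exists2 l : {additive R -> V}, l g != 0 &
       forall h p, G h -> h != g -> l (p * h) = 0) ->
  minimal_generating_set I G.
Proof.
move=> GI separated; split=> // H HG HI; apply/seteqP; split=> // g Gg.
have [l lg0 l0] := separated g Gg.
apply: contrapT => Hg; case/eqP: lg0.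
have : ideal_span H g by rewrite HI -GI; apply: ideal_span_gen.
case=> s sH ->; rewrite raddf_sum big_seq big1 // => ag /sH Hag.
by apply: l0; [apply: HG|apply/eqP => ag_g; apply: Hg; rewrite -ag_g].
Qed.

End IdealSpan.

(** * Minors of a matrix given by its columns *)

Section MinorsOfColumns.
Variable R : comNzRingType.
Implicit Types (s : seq (R * R)) (c : R * R).

Definition col_minor c d : R := c.1 * d.2 - d.1 * c.2.

Lemma minor2_mx_of_cols s (i j : 'I_(size s)) :
  minor2 (mx_of_cols s) i j = col_minor (nth (0, 0) s i) (nth (0, 0) s j).
Proof.
rewrite /minor2 (expand_det_row _ ord0) !big_ord_recl big_ord0 /cofactor.
rewrite !det_mx11 !mxE /= expr0 expr1 mul1r addr0 /col_minor.
by rewrite mulN1r mulrN.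
Qed.

Lemma minors2_colsP s p : minors2 (mx_of_cols s) p <->
  exists i j, [/\ (i < j)%N, (j < size s)%N &
                  p = col_minor (nth (0, 0) s i) (nth (0, 0) s j)].
Proof.
split=> [[i [j [ltij ->]]]|[i [j [ltij ltj ->]]]].
  by exists i, j; rewrite ltn_ord minor2_mx_of_cols.
exists (Ordinal (ltn_trans ltij ltj)), (Ordinal ltj).
by rewrite minor2_mx_of_cols.
Qed.

Lemma minors2_mapP (f : nat -> R * R) t p : sorted ltn t ->
  minors2 (mx_of_cols (map f t)) p <->
  exists a b : nat,
    [/\ a \in t, b \in t, (a < b)%N & p = col_minor (f a) (f b)].
Proof.
move=> lt_t; rewrite minors2_colsP size_map.
split=> [[i [j [ltij ltj ->]]]|[a [b [ta tb ltab ->]]]].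
  have lti := ltn_trans ltij ltj.
  exists (nth 0%N t i), (nth 0%N t j); rewrite !mem_nth // !(nth_map 0%N) //.
  by split=> //; apply: (sorted_ltn_nth ltn_trans 0%N lt_t).
exists (index a t), (index b t).
rewrite index_mem !(nth_map 0%N) ?index_mem // !nth_index //; split=> //.
rewrite ltnNge leq_eqVlt; apply/negP => /orP[/eqP eq_ba|lt_ba].
  by move: ltab; rewrite -(nth_index 0%N ta) -eq_ba nth_index // ltnn.
have ltba := sorted_ltn_index ltn_trans lt_t _ _ tb ta lt_ba.
by move: (ltn_trans ltab ltba); rewrite ltnn.
Qed.

Lemma minors2_first_col_consP c s p :
  minors2_first_col (mx_of_cols (c :: s)) p <->
  exists2 d, d \in s & p = col_minor c d.
Proof.
split=> [[i [[j ltj] [ltij i0 ->]]]|[d /(nthP (0, 0))[j ltj <-] ->]].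
  case: j ltj ltij => [|j] ltj; first by rewrite ltn0.
  exists (nth (0, 0) s j); first exact: mem_nth.
  by rewrite minor2_mx_of_cols i0.
exists ord0, (Ordinal (ltj : (j.+1 < size (c :: s))%N)).
by rewrite minor2_mx_of_cols.
Qed.

End MinorsOfColumns.

(** * Monomials and their degrees in the semigroup *)

Section Ring.
Variables (k : fieldType) (e n : nat).
Hypotheses (he : (10 <= e)%N) (hn : (2 <= n <= e - 2)%N).

Local Notation R := (Rg k e 1 n).
Local Notation x := (xvar k e 1 n).
Local Notation N := #|{: Defs.index e 1 n}|.
Local Notation G := (G_S k e n).

Definition valid (i : nat) := [&& (i < e)%N, i != 1%N & i != n].

Definition idx (j : 'I_N) : nat := val (val (enum_val j : Defs.index e 1 n)).

Lemma idx_valid j : valid (idx j).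
Proof. by rewrite /valid /idx ltn_ord (valP (enum_val j)). Qed.

Lemma xvar_idx j : x (idx j) = 'X_j.
Proof.
rewrite /xvar; case: pickP => [i /eqP eq_i|/(_ (enum_val j))]; last first.
  by rewrite eqxx.
suff -> : i = enum_val j by rewrite enum_valK.
by do 2!apply: val_inj.
Qed.

Lemma idx_inj : injective idx.
Proof. by move=> i j /val_inj/val_inj/enum_val_inj. Qed.

Lemma idx_onto i : valid i -> exists j, idx j = i.
Proof.
case/and3P=> lti i1 ni.
have Hi : (Ordinal lti != 1%N :> nat) && (Ordinal lti != n :> nat).
  by rewrite i1.
exists (enum_rank (Sub (Ordinal lti) Hi : Defs.index e 1 n)).
by rewrite /idx enum_rankK.
Qed.

Definition wdeg (m : 'X_{1..N}) : nat := \sum_j m j * (e + idx j).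

Lemma wdegD m1 m2 : wdeg (m1 + m2) = (wdeg m1 + wdeg m2)%N.
Proof.
by rewrite /wdeg -big_split; apply: eq_bigr => j _; rewrite mnmDE mulnDl.
Qed.

Lemma wdegU j : wdeg U_(j) = (e + idx j)%N.
Proof.
rewrite /wdeg (bigD1 j) //= big1 ?mnm1E ?eqxx ?mul1n ?addn0 // => i neq_ij.
by rewrite mnm1E eq_sym (negPf neq_ij).
Qed.

Lemma phiE (p : R) :
  phi p = \sum_(m <- msupp p) (p@_m)%:P * 'X^(wdeg m).
Proof.
rewrite /phi /mmap; apply: eq_bigr => m _; congr (_ * _).
rewrite /mmap1 /wdeg; elim/big_rec2: _ => [|j d p1 _ ->].
  by rewrite expr0.
by rewrite [RHS]exprD mulnC exprM.
Qed.

Lemma phiX m : phi ('X_[m] : R) = 'X^(wdeg m).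
Proof. by rewrite phiE msuppX big_seq1 mcoeffX eqxx mul1r. Qed.

Lemma phi0 : phi (0 : R) = 0.
Proof. exact: mmap0. Qed.

Lemma phiD (p q : R) : phi (p + q) = phi p + phi q.
Proof. exact: mmapD. Qed.

Lemma phiB (p q : R) : phi (p - q) = phi p - phi q.
Proof. exact: mmapB. Qed.

Lemma phiM (p q : R) : phi (p * q) = phi p * phi q.
Proof. exact: rmorphM. Qed.

Lemma phi_xvar i : valid i -> phi (x i) = 'X^(e + i).
Proof. by move=> /idx_onto[j <-]; rewrite xvar_idx phiX wdegU. Qed.

(** * The generators as links between consecutive factorizations *)

(** The monomials [x_a x_(s - a)], listed by their smaller index [a]. *)
Definition pair s a := [&& (a.*2 <= s)%N, valid a & valid (s - a)].

Definition gap_pairs s a b := forall c, (a < c < b)%N -> ~~ pair s c.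
Definition first_pair s b := forall c, (c < b)%N -> ~~ pair s c.

Definition pair_mon s a : R := x a * x (s - a).

(** Three indices add up to [t] unless [t = 1], or [t = n] is [2] or [3]. *)
Definition has_cubic (t : nat) := (t != 1%N) && ((t != n) || (4 <= n)%N).

(** One product of three variables with index sum [t] is enough to represent
    them all, except [x_2 ^ 3] when [n = 4]. *)
Definition cubic (t : nat) : R :=
  if t == n then x 0 * x 2 * x (n - 2) else x 0 ^+ 2 * x t.

(** Among the differences of products of two variables, the minors have the
    product that comes first in the list with sign [+], and those in [L_(e,n)]
    have it with sign [-]. *)
Definition flipped (a b : nat) :=
  (n != 2%N) && ((a != 0%N) && (b == a.+2) || (b == a.+3)).

Inductive link : R -> Prop :=
| link_pair s a b of pair s a & pair s b & (a < b)%N & gap_pairs s a b :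
    link ((-1) ^+ flipped a b * (pair_mon s a - pair_mon s b))
| link_cubic t b of has_cubic t & pair (e + t) b & first_pair (e + t) b :
    link (cubic t - pair_mon (e + t) b)
| link_cube of n = 4%N : link (x 2 ^+ 3 - x 7 * x (e - 1)).

Lemma link_pairW (sg : bool) a a' b b' p :
    [/\ valid a, valid a', valid b & valid b'] ->
    [/\ (a + a' = b + b')%N, (a < b)%N & (b <= b')%N] ->
    (forall c c', (a < c < b)%N -> (c + c' = a + a')%N -> valid c ->
      ~~ valid c') ->
    sg = flipped a b -> p = (-1) ^+ sg * (x a * x a' - x b * x b') ->
  link p.
Proof.
move=> [va va' vb vb'] [eq_s ltab lebb'] gap -> ->.
have := @link_pair (a + a') a b; rewrite /pair /pair_mon addKn eq_s addKn.
rewrite va va' vb vb' !andbT; apply=> //; try lia.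
move=> c ltc; apply/negP => /and3P[lec vc vc'].
have : ~~ valid (b + b' - c) by apply: (gap c) => //; lia.
by rewrite vc'.
Qed.

Lemma link_cubicW t b b' p :
    has_cubic t -> [/\ valid b, valid b', (e + t = b + b')%N & (b <= b')%N] ->
    (forall c c', (c < b)%N -> (c + c' = e + t)%N -> valid c -> ~~ valid c') ->
    p = cubic t - x b * x b' ->
  link p.
Proof.
move=> ct [vb vb' eq_s lebb'] gap ->.
have := @link_cubic t b ct; rewrite /pair /pair_mon eq_s addKn vb vb' !andbT.
apply=> //; first lia.
move=> c ltc; apply/negP => /and3P[lec vc vc'].
have : ~~ valid (b + b' - c) by apply: (gap c) => //; lia.
by rewrite vc'.
Qed.

(** The columns of [A_n] are indexed by their top entries, [x_(e - 1)] included;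
    the comparison of two columns is then that of their indices. *)
Definition A_rows := index_iota 2 n.-1 ++ index_iota n.+1 e.
Definition A_col (a : nat) : R * R :=
  (x a, if a == e.-1 then x 0 ^+ 2 else x a.+1).

Lemma mem_A_rows a : (a \in A_rows) = (2 <= a < n.-1)%N || (n < a < e)%N.
Proof. by rewrite mem_cat !mem_index_iota. Qed.

Lemma A_rows_sorted : sorted ltn A_rows.
Proof.
rewrite (sorted_pairwise ltn_trans) pairwise_cat.
rewrite -!(sorted_pairwise ltn_trans) !iota_ltn_sorted !andbT.
by apply/allrelP => a b; rewrite !mem_index_iota /=; lia.
Qed.

Lemma A_colsE : A_cols k e n = map A_col A_rows.
Proof.
have -> : A_rows = index_iota 2 n.-1 ++ index_iota n.+1 e.-1 ++ [:: e.-1].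
  rewrite /A_rows /index_iota; congr (_ ++ _).
  have -> : (e - n.+1 = (e.-1 - n.+1) + 1)%N by lia.
  by rewrite iotaD; congr (_ ++ [:: _]); lia.
rewrite !map_cat /A_cols /=; congr (_ ++ (_ ++ [:: _])); last first.
  by rewrite /A_col eqxx.
all: apply/eq_in_map => a; rewrite mem_index_iota /A_col => lta.
all: by rewrite (_ : (a == e.-1) = false) //; apply/eqP; lia.
Qed.

Lemma J_minorP p : @Defs.J k e n p <->
  exists a b : nat, [/\ a \in A_rows, b \in A_rows, (a < b)%N &
                  p = col_minor (A_col a) (A_col b)].
Proof. by rewrite /Defs.J A_colsE; apply: minors2_mapP A_rows_sorted. Qed.

(** The first column of [B_n] ties the factorization containing [x_0] to the
    next one, which contains [x_2], or [x_3] when [n = 2]. *)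
Definition B_step := if n == 2%N then 3%N else 2%N.

Definition B_row (i : nat) :=
  [&& (B_step <= i)%N, (i + B_step < e)%N, i != n, (i + B_step)%N != n
    & i != 1%N].

Lemma K_minorP p : @Defs.K k e n p <->
  (exists2 i, B_row i & p = col_minor (x 0, x B_step) (x i, x (i + B_step))) \/
  (n != e - 2)%N /\
  p = col_minor (x 0, x B_step) (x (e - B_step), x 0 ^+ 2).
Proof.
rewrite /Defs.K /B_cols /B_row /B_step; case: ifP => n2.
  rewrite minors2_first_col_consP; split=> [[d]|].
    rewrite mem_cat mem_seq1 => /orP[/mapP[i]|/eqP->].
      by rewrite mem_index_iota => lti -> ->; left; exists i => //; lia.
    by move=> ->; right; split=> //; lia.
  case=> [[i ri ->]|[_ ->]].
    exists (x i, x (i + 3)) => //; rewrite mem_cat map_f //.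
    by rewrite mem_index_iota; lia.
  by exists (x (e - 3), x 0 ^+ 2); rewrite // mem_cat mem_seq1 eqxx orbT.
rewrite minors2_first_col_consP; split=> [[d]|].
  rewrite mem_cat in_cons mem_cat => /or4P[/mapP[i]|/eqP->|/mapP[i]|].
  - by rewrite mem_index_iota => lti -> ->; left; exists i => //; lia.
  - move=> ->; left; exists (n - 1)%N; first lia.
    by congr (col_minor _ (_, x _)); lia.
  - by rewrite mem_index_iota => lti -> ->; left; exists i => //; lia.
  - case: ifP => ne; first by rewrite in_nil.
    by rewrite mem_seq1 => /eqP-> ->; right; split=> //; move/negbT: ne.
case=> [[i ri ->]|[ne ->]]; last first.
  exists (x (e - 2), x 0 ^+ 2) => //.
  by rewrite mem_cat in_cons mem_cat (negPf ne) mem_seq1 eqxx !orbT.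
exists (x i, x (i + 2)) => //; rewrite mem_cat in_cons mem_cat.
have [lti|lti] := ltnP i (n - 2); first by rewrite map_f // mem_index_iota; lia.
have [->|ni] := eqVneq i (n - 1)%N.
  by rewrite (_ : (n - 1 + 2 = n + 1)%N) ?eqxx ?orbT //; lia.
by rewrite [X in [|| _, _, X | _]]map_f ?orbT // mem_index_iota; lia.
Qed.

Ltac link_side := rewrite /has_cubic /flipped /valid; try split; intros; lia.

Lemma L_cases : @Defs.L k e n =
  if n == 2%N then set0 else if n == 3%N then @L3 k e n else
  if n == 4%N then @L4 k e n else if n == (e - 3)%N then @L_e3 k e n else
  if n == (e - 2)%N then @L_e2 k e n else @L_mid k e n.
Proof. by []. Qed.

Lemma J_link p : @Defs.J k e n p -> link p.
Proof.
case/J_minorP=> a [b]; rewrite !mem_A_rows => -[ra rb ltab ->].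
rewrite /col_minor /A_col /= (_ : (a == e.-1) = false); last by apply/eqP; lia.
case: ifP => be.
  apply: (@link_cubicW a a.+1 b); try link_side.
  by rewrite /cubic (_ : (a == n) = false); [ring|lia].
apply: (@link_pairW false a b.+1 a.+1 b); try link_side; ring.
Qed.

Lemma K_link p : @Defs.K k e n p -> link p.
Proof.
case/K_minorP=> [[i]|[ne]]; rewrite /B_row /B_step /col_minor /=.
all: case: ifP => n2.
- move=> ri ->; apply: (@link_pairW false 0 (i + 3) 3 i); try link_side.
  by ring.
- move=> ri ->; apply: (@link_pairW false 0 (i + 2) 2 i); try link_side.
  by ring.
- move=> ->; apply: (@link_cubicW 0 3 (e - 3)); try link_side.
  by rewrite /cubic (_ : (0%N == n) = false); [ring|lia].
- move=> ->; apply: (@link_cubicW 0 2 (e - 2)); try link_side.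
  by rewrite /cubic (_ : (0%N == n) = false); [ring|lia].
Qed.

Lemma L_link p : @Defs.L k e n p -> link p.
Proof.
rewrite L_cases; case: ifP => [//|/eqP n2].
case: ifP => [/eqP n3|/eqP n3].
  case=> [[i /= lei <-]|->].
    apply: (@link_pairW true 2 (6 + i) 4 (4 + i));
      first [link_side|ring].
  apply: (@link_cubicW 2 4 (e - 2)); try link_side.
  by rewrite /cubic n3.
case: ifP => [/eqP n4|/eqP n4].
  case=> [[[i /= lei <-]|->]|[[->|->]|->]].
  - apply: (@link_pairW true 3 (7 + i) 5 (5 + i));
      first [link_side|ring].
  - apply: (@link_pairW true 0 6 3 3);
      first [link_side|ring].
  - by apply: (@link_cubicW 3 5 (e - 2)); try link_side; rewrite /cubic n4.
  - apply: (@link_cubicW 4 5 (e - 1)); try link_side.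
    by rewrite /cubic n4 /=; ring.
  - exact: link_cube.
case: ifP => [/eqP ne3|/eqP ne3].
  case=> [[[i /= lei <-]|->]|[->|->]].
  - apply: (@link_pairW true (e - 6 - i) (e - 2) (e - 4 - i) (e - 4));
      first [link_side|ring].
  - apply: (@link_pairW true 0 (e - 1) 3 (e - 4));
      first [link_side|ring].
  - apply: (@link_cubicW (e - 4) (e - 2) (e - 2)); try link_side.
    by rewrite /cubic (_ : (_ == n) = false) //; lia.
  - apply: (@link_cubicW n (e - 2) (e - 1)); try link_side.
    by rewrite /cubic eqxx (_ : (n - 2 = e - 5)%N) //; lia.
case: ifP => [/eqP ne2|/eqP ne2].
  case=> [[i /= lei <-]|[->|->]].
  - apply: (@link_pairW true (e - 5 - i) (e - 1) (e - 3 - i) (e - 3));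
      first [link_side|ring].
  - apply: (@link_cubicW 0 3 (e - 3)); try link_side.
    by rewrite /cubic (_ : (0%N == n) = false); [ring|lia].
  - apply: (@link_cubicW n (e - 1) (e - 1)); try link_side.
    by rewrite /cubic eqxx (_ : (n - 2 = e - 4)%N) //; lia.
case=> [[[[i /= lei <-]|[i /= lei <-]]|->]|[->|->]].
- apply: (@link_pairW true (n - 1) (n + 3 + i) (n + 1) (n + 1 + i));
    first [link_side|ring].
- apply: (@link_pairW true (n - 3 - i) (n + 1) (n - 1 - i) (n - 1));
    first [link_side|ring].
- apply: (@link_pairW true 0 (n + 2) 3 (n - 1));
    first [link_side|ring].
- apply: (@link_cubicW (n - 1) (n + 1) (e - 2)); try link_side.
  by rewrite /cubic (_ : (_ == n) = false) //; lia.
- apply: (@link_cubicW n (n + 1) (e - 1)); try link_side.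
  by rewrite /cubic eqxx.
Qed.

Lemma J_pair a b p : [/\ valid a, valid a.+1, valid b & valid b.+1] ->
  (2 <= a < b)%N -> p = x a * x b.+1 - x b * x a.+1 -> @Defs.J k e n p.
Proof.
rewrite /valid => -[va va1 vb vb1] lab ->; apply/J_minorP; exists a, b.
rewrite !mem_A_rows /col_minor /A_col /=.
have [-> ->] : (a == e.-1) = false /\ (b == e.-1) = false by lia.
by split=> //; lia.
Qed.

Lemma J_cubic a p : valid a -> valid a.+1 -> (2 <= a)%N ->
  p = x a * x 0 ^+ 2 - x e.-1 * x a.+1 -> @Defs.J k e n p.
Proof.
rewrite /valid => va va1 la ->; apply/J_minorP; exists a, e.-1.
have ae : (a == e.-1) = false by lia.
rewrite !mem_A_rows /col_minor /A_col /= eqxx ae.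
by split=> //; lia.
Qed.

Lemma J_G p : @Defs.J k e n p -> G p. Proof. by left; left. Qed.
Lemma K_G p : @Defs.K k e n p -> G p. Proof. by left; right. Qed.

Lemma L3_G p : n = 3%N -> @L3 k e n p -> G p.
Proof.
by move=> nE Lp; right; rewrite L_cases; do ![case: eqP => ? //]; lia.
Qed.

Lemma L4_G p : n = 4%N -> @L4 k e n p -> G p.
Proof.
by move=> nE Lp; right; rewrite L_cases; do ![case: eqP => ? //]; lia.
Qed.

Lemma L_e3_G p : n = (e - 3)%N -> @L_e3 k e n p -> G p.
Proof.
by move=> nE Lp; right; rewrite L_cases; do ![case: eqP => ? //]; lia.
Qed.

Lemma L_e2_G p : n = (e - 2)%N -> @L_e2 k e n p -> G p.
Proof.
by move=> nE Lp; right; rewrite L_cases; do ![case: eqP => ? //]; lia.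
Qed.

Lemma L_mid_G p : (5 <= n <= e - 4)%N -> @L_mid k e n p -> G p.
Proof.
by move=> nE Lp; right; rewrite L_cases; do ![case: eqP => ? //]; lia.
Qed.

Lemma first_pair_unique s b b' : pair s b -> pair s b' ->
  first_pair s b -> first_pair s b' -> b = b'.
Proof.
move=> sb sb' gap gap'; case: (ltngtP b b') => // [/gap'|/gap].
  by rewrite sb.
by rewrite sb'.
Qed.

(** The first pair after the products of three variables has smaller index
    [t + 1], the next index when [t + 1] is missing, and [2] or [3] for
    [t = 0]. *)
Lemma cubic_link_G t b :
    has_cubic t -> pair (e + t) b -> first_pair (e + t) b ->
  G (cubic t - pair_mon (e + t) b).
Proof.
move=> ct etb gap; have lebt : (t <= e - 2)%N.
  by move: etb; rewrite /pair /valid; lia.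
have bE b' : pair (e + t) b' -> first_pair (e + t) b' -> b = b'.
  by move=> etb'; apply: first_pair_unique.
have [t0|t0] := posnP t.
  rewrite /cubic /pair_mon t0 addn0 (_ : (0%N == n) = false); last lia.
  have [n2|n2] := eqVneq n (e - 2)%N; last first.
    apply/K_G/K_minorP; right; split=> //; rewrite /col_minor /= /B_step.
    case: ifP => n3.
      have -> : b = 3%N by apply: bE => [|c ltc]; rewrite /pair /valid; lia.
      by ring.
    have -> : b = 2%N by apply: bE => [|c ltc]; rewrite /pair /valid; lia.
    by ring.
  apply: L_e2_G => //; right; left.
  have -> : b = 3%N by apply: bE => [|c ltc]; rewrite /pair /valid; lia.
  by rewrite /=; ring.
have [tn|tn] := eqVneq t n.
  have lt4n : (4 <= n)%N by move: ct; rewrite /has_cubic; lia.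
  have -> : b = (n + 1)%N by apply: bE => [|c ltc]; rewrite /pair /valid; lia.
  have eb' : (e + t - (n + 1))%N = (e - 1)%N by lia.
  rewrite /cubic /pair_mon eb' tn eqxx.
  have [n4|n4] := eqVneq n 4%N.
    apply: L4_G => //; right; left; right.
    have [-> ->] : (n - 2 = 2 /\ n + 1 = 5)%N by lia.
    by rewrite /=; ring.
  have [n3|n3] := eqVneq n (e - 3)%N.
    apply: L_e3_G => //; right; right.
    by have [-> ->] : (n - 2 = e - 5 /\ n + 1 = e - 2)%N by lia.
  have [n2|n2] := eqVneq n (e - 2)%N.
    apply: L_e2_G => //; right; right.
    by have [-> ->] : (n - 2 = e - 4 /\ n + 1 = e - 1)%N by lia.
  by apply: L_mid_G; [lia|right; right].
rewrite /cubic (negPf tn).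
have t1 : t != 1%N by move: ct; rewrite /has_cubic; lia.
have [tn1|tn1] := eqVneq t.+1 n; last first.
  have -> : b = t.+1 by apply: bE => [|c ltc]; rewrite /pair /valid; lia.
  rewrite /pair_mon (_ : (e + t - t.+1 = e.-1)%N); last lia.
  by apply/J_G/(@J_cubic t); rewrite /valid; [lia|lia|lia|ring].
have n2 : n != (e - 2)%N.
  by apply/eqP => n2; move: etb; rewrite /pair /valid; lia.
have -> : b = (n + 1)%N by apply: bE => [|c ltc]; rewrite /pair /valid; lia.
rewrite /pair_mon (_ : (e + t - (n + 1) = e - 2)%N); last lia.
have [n3|n3] := eqVneq n 3.
  by apply: L3_G => //; right; have [-> ->] : (t = 2 /\ n + 1 = 4)%N by lia.
have [n4|n4] := eqVneq n 4.
  apply: L4_G => //; right; left; left.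
  by have [-> ->] : (t = 3 /\ n + 1 = 5)%N by lia.
have [ne3|ne3] := eqVneq n (e - 3)%N.
  apply: L_e3_G => //; right; left.
  by have [-> ->] : (t = e - 4 /\ n + 1 = e - 2)%N by lia.
by apply: L_mid_G; [lia|right; left; have -> : (t = n - 1)%N by lia].
Qed.

(** Only pairs that involve [1] or [n] can be missing between [a] and [b], so
    [b <= a + 3], and beyond [a = 0] even [b <= a + 2]. *)
Lemma pair_link_G s a b :
    pair s a -> pair s b -> (a < b)%N -> gap_pairs s a b ->
  G ((-1) ^+ flipped a b * (pair_mon s a - pair_mon s b)).
Proof.
move=> sa sb ltab gap.
have next c : (a < c)%N -> (c < b)%N -> ~~ pair s c.
  by move=> *; apply: gap; lia.
move: (sa) (sb) => /and3P[lea va va'] /and3P[leb vb vb'].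
have a1 : a != 1%N by move: va; rewrite /valid; lia.
have [b1|b1] := eqVneq b a.+1.
  rewrite /pair_mon b1 (_ : flipped _ _ = false) ?mul1r; last first.
    by rewrite /flipped; lia.
  have es : (s - a = (s - a.+1).+1)%N by lia.
  apply/J_G/(@J_pair a (s - a.+1)%N); last by rewrite es; ring.
    by rewrite -es -b1; split.
  by move: vb; rewrite /valid; lia.
have ltb1 : (a.+1 < b)%N by lia.
have [a0|a0] := posnP a.
  have [n2|n2] := eqVneq n 2%N.
    have b3 : b = 3%N.
      have := next 3%N; move: va' vb vb'; rewrite a0 /pair /valid; lia.
    rewrite (_ : flipped a b = false) ?mul1r; last by rewrite /flipped; lia.
    rewrite /pair_mon a0 b3 subn0.
    apply/K_G/K_minorP; left; exists (s - 3)%N.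
      by move: va' vb'; rewrite /B_row /B_step n2 a0 b3 /valid /=; lia.
    have -> : B_step = 3%N by rewrite /B_step n2.
    rewrite /col_minor /= (_ : (s - 3 + 3 = s)%N); last lia.
    by ring.
  have [b2|b2] := eqVneq b 2.
    rewrite (_ : flipped a b = false) ?mul1r; last by rewrite /flipped; lia.
    rewrite /pair_mon a0 b2 subn0; apply/K_G/K_minorP; left.
    exists (s - 2)%N.
      by move: va' vb'; rewrite /B_row /B_step (negPf n2) a0 b2 /valid; lia.
    have -> : B_step = 2%N by rewrite /B_step (negPf n2).
    rewrite /col_minor /= (_ : (s - 2 + 2 = s)%N); last lia.
    by ring.
  have es : s = (n + 2)%N.
    have := next 2%N; move: va' vb'; rewrite a0 /pair /valid; lia.
  have b3 : b = 3%N.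
    have := next 3%N; move: va' vb'; rewrite a0 /pair /valid; lia.
  rewrite (_ : flipped a b = true); last by rewrite /flipped; lia.
  rewrite /pair_mon es a0 b3 subn0 (_ : (n + 2 - 3 = n - 1)%N); last lia.
  have [n4|n4] := eqVneq n 4.
    apply: L4_G => //; left; right.
    have [-> ->] : (n + 2 = 6 /\ n - 1 = 3)%N by lia.
    by rewrite /=; ring.
  have [ne3|ne3] := eqVneq n (e - 3)%N.
    apply: L_e3_G => //; left; right.
    have [-> ->] : (n + 2 = e - 1 /\ n - 1 = e - 4)%N by lia.
    by rewrite /=; ring.
  apply: L_mid_G; first by move: va'; rewrite /valid; lia.
  by left; right; rewrite /=; ring.
have gapE c : (a < c)%N -> (c < b)%N -> c = n \/ (s - c)%N = n.
  move=> ltac ltcb; case: (eqVneq c n) => [|cn]; first by left.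
  case: (eqVneq (s - c)%N n) => [|scn]; first by right.
  have := next c ltac ltcb => /negP[]; apply/and3P.
  by move: va' vb'; rewrite /valid; split; lia.
have b2 : b = a.+2 by have := gapE a.+1; have := gapE a.+2; lia.
have {}gapE : a.+1 = n \/ (s - a.+1)%N = n by apply: gapE; lia.
rewrite (_ : flipped a b = true); last first.
  by move: va vb'; rewrite /flipped /valid b2; lia.
have [an|an] := eqVneq a.+1 n.
  rewrite /pair_mon (_ : s - a = s - b + 2)%N; last lia.
  have [n3|n3] := eqVneq n 3.
    apply: L3_G => //; left; exists (s - b - 4)%N => /=.
      by move: va'; rewrite /valid; lia.
    have [-> -> -> ->] : [/\ a = 2, b = 4, 6 + (s - b - 4) = s - b + 2
      & 4 + (s - b - 4) = s - b]%N by split; lia.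
    by ring.
  have [n4|n4] := eqVneq n 4.
    apply: L4_G => //; left; left; exists (s - b - 5)%N => /=.
      by move: va'; rewrite /valid; lia.
    have [-> -> -> ->] : [/\ a = 3, b = 5, 7 + (s - b - 5) = s - b + 2
      & 5 + (s - b - 5) = s - b]%N by split; lia.
    by ring.
  apply: L_mid_G; first by move: va'; rewrite /valid; lia.
  left; left; left; exists (s - b - n - 1)%N => /=.
    by move: va'; rewrite /valid; lia.
  have [-> -> -> ->] : [/\ (n - 1 = a), (n + 1 = b),
    n + 3 + (s - b - n - 1) = s - b + 2 & n + 1 + (s - b - n - 1) = s - b]%N.
    by split; lia.
  by ring.
have sn : s = (a + n).+1 by lia.
have [ea eb] : (s - a = n + 1 /\ s - b = n - 1)%N by lia.
rewrite /pair_mon ea eb.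
have [ne3|ne3] := eqVneq n (e - 3)%N.
  apply: L_e3_G => //; left; left; exists (e - 4 - b)%N => /=; first by lia.
  have [-> -> -> ->] : [/\ n + 1 = e - 2, n - 1 = e - 4, e - 4 - (e - 4 - b) = b
    & e - 6 - (e - 4 - b) = a]%N by split; lia.
  by ring.
have [ne2|ne2] := eqVneq n (e - 2)%N.
  apply: L_e2_G => //; left; exists (e - 3 - b)%N => /=; first by lia.
  have [-> -> -> ->] : [/\ n + 1 = e - 1, n - 1 = e - 3, e - 3 - (e - 3 - b) = b
    & e - 5 - (e - 3 - b) = a]%N by split; lia.
  by ring.
apply: L_mid_G; first by move: vb'; rewrite /valid; lia.
left; left; right; exists (n - 1 - b)%N => /=; first by lia.
have [-> ->] : [/\ n - 1 - (n - 1 - b) = b & n - 3 - (n - 1 - b) = a]%N.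
  by split; lia.
by ring.
Qed.

Lemma G_linkE p : G p <-> link p.
Proof.
split; first by case=> [[/J_link|/K_link]|/L_link].
case=> [s a b|t b|n4]; [exact: pair_link_G|exact: cubic_link_G|].
by apply: L4_G => //; right; right.
Qed.

(** * Rewriting products of two variables *)

Local Notation "p =G q" := (congr_mod G p q) (at level 70).

Lemma link_congr p q : link (p - q) -> p =G q.
Proof. by move=> /G_linkE; apply: ideal_span_gen. Qed.

(** Induction along the list of pairs: [c] is the pair just before [b]. *)
Lemma pair_congr s a b : pair s a -> pair s b -> pair_mon s a =G pair_mon s b.
Proof.
wlog leab : a b / (a <= b)%N.
  by move=> W sa sb; have [/W|/ltnW/W/(_ sb sa)/congr_sym] := leqP a b; apply.
elim/ltn_ind: b leab => b IHb leab sa sb.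
have [->|neq_ab] := eqVneq a b; first exact: congr_refl.
have exc : exists c, (c < b)%N && pair s c by exists a; rewrite sa andbT; lia.
have bnd c : (c < b)%N && pair s c -> (c <= b)%N by case/andP=> /ltnW.
have [c /andP[ltcb sc] maxc] := ex_maxnP exc bnd.
have leac : (a <= c)%N by apply: maxc; rewrite sa andbT; lia.
apply: (congr_trans (IHb c ltcb leac sa sc)).
have /G_linkE : link ((-1) ^+ flipped c b * (pair_mon s c - pair_mon s b)).
  apply: link_pair => // d /andP[ltcd ltdb]; apply/negP => sd.
  by have := maxc d; rewrite ltdb sd => /(_ isT); lia.
move=> /ideal_span_gen/(ideal_spanM ((-1) ^+ flipped c b)).
by rewrite mulrA -expr2 -exprM mulnC exprM sqrrN expr1n expr1n mul1r.
Qed.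

Lemma quad_congr i i' j j' : [/\ valid i, valid i', valid j & valid j'] ->
  (i + i' = j + j')%N -> x i * x i' =G x j * x j'.
Proof.
have sorted_case a a' b b' : [/\ valid a, valid a', valid b & valid b'] ->
    (a <= a')%N -> (b <= b')%N -> (a + a' = b + b')%N ->
    x a * x a' =G x b * x b'.
  case=> va va' vb vb' lea leb eq_s.
  have := @pair_congr (a + a') a b; rewrite /pair_mon {4}eq_s !addKn; apply.
    by rewrite /pair addKn va va'; lia.
  by rewrite /pair eq_s addKn vb vb'; lia.
case=> vi vi' vj vj' eq_s.
have [lei|/ltnW lei] := leqP i i'; have [lej|/ltnW lej] := leqP j j'.
- exact: sorted_case.
- by rewrite [x j * _]mulrC; apply: sorted_case => //; lia.
- by rewrite [x i * _]mulrC; apply: sorted_case => //; lia.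
- by rewrite mulrC [x j * _]mulrC; apply: sorted_case => //; lia.
Qed.

Lemma cubic_congr t i i' : has_cubic t -> valid i -> valid i' ->
  (i + i' = e + t)%N -> x i * x i' =G cubic t.
Proof.
move=> ct; wlog lei : i i' / (i <= i')%N.
  move=> W vi vi' eq_s; have [lei|/ltnW lei] := leqP i i'; first exact: W.
  by rewrite mulrC; apply: W => //; rewrite addnC.
move=> vi vi' eq_s.
have si : pair (e + t) i by rewrite /pair -eq_s addKn vi vi'; lia.
have [b sb minb] := ex_minnP (ex_intro (fun b => pair (e + t) b) i si).
have firstb : first_pair (e + t) b.
  by move=> c ltcb; apply/negP => /minb; lia.
apply: congr_trans (congr_sym (link_congr (link_cubic ct sb firstb))).
by have := pair_congr si sb; rewrite {1}/pair_mon -{1}eq_s addKn.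
Qed.

(** * Normal forms *)

(** Monomials whose degrees are the least elements of the semigroup in their
    classes modulo [e]: the residues [1] and [n], which no variable has, need
    products of two variables. *)
Definition apery (r : nat) : R :=
  if r == 0%N then 1
  else if r == 1%N then if n == 2%N then x 3 * x (e - 2) else x 2 * x (e - 1)
  else if r == n then
    if n == 2%N then x 3 * x (e - 1) else
    if n == 3%N then x 4 * x (e - 1) else x 2 * x (n - 2)
  else x r.

(** The quotient by [e] of the degree of [apery r]. *)
Definition apery_quo (r : nat) : nat :=
  if r == 0%N then 0%N else if r == 1%N then 3%N
  else if r == n then if (n <= 3)%N then 3%N else 2%N else 1%N.

Definition normal_form d : R :=
  x 0 ^+ (d %/ e - apery_quo (d %% e)) * apery (d %% e).

(** Intended for monomials [p] of degree [d]; the inequality says that [d] lies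
    in the semigroup, so that the truncated difference in [normal_form] is a true
    one. *)
Definition reduces p d :=
  (apery_quo (d %% e) <= d %/ e)%N /\ p =G normal_form d.

Lemma reducesI q r d p :
    (r < e)%N -> d = (q * e + r)%N -> (apery_quo r <= q)%N ->
  p =G x 0 ^+ (q - apery_quo r) * apery r -> reduces p d.
Proof.
move=> ltr -> leq_q pE; rewrite /reduces /normal_form.
have e0 : (0 < e)%N by lia.
by rewrite divnMDl // modnMDl (divn_small ltr) (modn_small ltr) addn0.
Qed.

Lemma reduces_congr p p' d : p =G p' -> reduces p' d -> reduces p d.
Proof. by move=> pp' [qd p'E]; split=> //; exact: congr_trans pp' p'E. Qed.

Lemma reduces_x0 c p d : reduces p d -> reduces (x 0 ^+ c * p) (c * e + d).
Proof.
case=> qd pE; have e0 : (0 < e)%N by lia.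
apply: (@reducesI (c + d %/ e) (d %% e)); rewrite ?ltn_mod //.
- by rewrite mulnDl -addnA -divn_eq.
- exact: leq_trans qd (leq_addl _ _).
by rewrite -addnBA // exprD -mulrA; apply: congrMl.
Qed.

Lemma valid0 : valid 0. Proof. by rewrite /valid; lia. Qed.

Lemma aperyE r : r != 0%N -> r != 1%N -> r != n -> apery r = x r.
Proof. by rewrite /apery => /negPf-> /negPf-> /negPf->. Qed.

Lemma apery_quoE r : r != 0%N -> r != 1%N -> r != n -> apery_quo r = 1%N.
Proof. by rewrite /apery_quo => /negPf-> /negPf-> /negPf->. Qed.

Lemma apery_1 : apery 1 = if n == 2%N then x 3 * x (e - 2) else x 2 * x (e - 1).
Proof. by []. Qed.

Lemma apery_quo_1 : apery_quo 1 = 3%N. Proof. by []. Qed.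

Lemma apery_n : apery n = if n == 2%N then x 3 * x (e - 1) else
  if n == 3%N then x 4 * x (e - 1) else x 2 * x (n - 2).
Proof.
have [n0 n1] : (n == 0%N) = false /\ (n == 1%N) = false by lia.
by rewrite /apery n0 n1 eqxx.
Qed.

Lemma apery_quo_n : apery_quo n = if (n <= 3)%N then 3%N else 2%N.
Proof.
have [n0 n1] : (n == 0%N) = false /\ (n == 1%N) = false by lia.
by rewrite /apery_quo n0 n1 eqxx.
Qed.

Lemma reduces_mul2 i j : valid i -> valid j ->
  reduces (x i * x j) (2 * e + (i + j)).
Proof.
wlog leij : i j / (i <= j)%N.
  move=> W vi vj; have [leij|/ltnW leji] := leqP i j; first exact: W.
  by rewrite mulrC (addnC i j); apply: W.
move=> vi vj; have v0 := valid0.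
have vP l : (l < e)%N -> l != 1%N -> l != n -> valid l.
  by rewrite /valid => -> -> ->.
have [lie l1 ln] := and3P vi; have [lje j1 jn] := and3P vj.
have [i0|i0] := posnP i.
  have [j0|j0] := posnP j.
    rewrite i0 j0; apply: (@reducesI 2 0) => //; try lia.
    by rewrite /apery mulr1 expr2; apply: congr_refl.
  apply: (@reducesI 2 j); rewrite ?aperyE ?apery_quoE //; try lia.
  by rewrite i0; apply: congr_refl.
have [lts|les] := ltnP (i + j) e.
  have [sn|sn] := eqVneq (i + j)%N n.
    have n4 : (4 <= n)%N by lia.
    have qn : apery_quo n = 2%N by rewrite apery_quo_n ifN //; lia.
    have wn : apery n = x 2 * x (n - 2) by rewrite apery_n !ifN //; lia.
    apply: (@reducesI 2 n); rewrite ?wn ?qn //; try lia.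
    by rewrite subnn mul1r; apply: quad_congr; [split; rewrite ?vP|]; lia.
  apply: (@reducesI 2 (i + j)); rewrite ?aperyE ?apery_quoE //; try lia.
  by apply: quad_congr; [split; rewrite ?vP|]; lia.
have [t et] : exists t, (i + j = e + t)%N by exists (i + j - e)%N; lia.
rewrite et.
have [t1|t1] := eqVneq t 1%N.
  apply: (@reducesI 3 1); rewrite ?apery_1 ?apery_quo_1 //; try lia.
  rewrite subnn mul1r; case: eqP => n2.
    by apply: quad_congr; [split; rewrite ?vP|]; lia.
  by apply: quad_congr; [split; rewrite ?vP|]; lia.
have [tn|tn] := eqVneq t n; last first.
  have vt : valid t by rewrite vP; lia.
  apply: (@reducesI 3 t); try lia.
    by rewrite /apery_quo; case: ifP => // _; rewrite !ifN.
  apply: congr_trans (cubic_congr _ vi vj et) _.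
    by rewrite /has_cubic t1 tn.
  rewrite /cubic (negPf tn); have [->|t0] := eqVneq t 0%N.
    by rewrite mulr1 -exprSr; apply: congr_refl.
  by rewrite aperyE ?apery_quoE //; apply: congr_refl.
have [n3|n4] := leqP n 3.
  have qn : apery_quo n = 3%N by rewrite apery_quo_n n3.
  apply: (@reducesI 3 n); rewrite ?qn //; try lia.
  rewrite subnn mul1r apery_n; case: eqP => n2.
    by apply: quad_congr; [split; rewrite ?vP|]; lia.
  rewrite ifT; last lia.
  by apply: quad_congr; [split; rewrite ?vP|]; lia.
have qn : apery_quo n = 2%N by rewrite apery_quo_n ifN // -ltnNge.
have wn : apery n = x 2 * x (n - 2) by rewrite apery_n !ifN //; lia.
apply: (@reducesI 3 n); rewrite ?wn ?qn //; try lia.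
apply: congr_trans (cubic_congr _ vi vj et) _.
  by rewrite /has_cubic; lia.
by rewrite /cubic tn eqxx mulrA; exact: congr_refl.
Qed.

(** A product of three variables reduces as soon as two of its indices add up
    to an index, possibly after subtracting [e] ([reduces_carry1]): a power of
    [x_0] splits off and a product of two variables is left. *)
Lemma reduces_carry0 i j m p d :
    [/\ valid i, valid j, valid m & valid (i + j)] -> p = x i * x j * x m ->
    d = (3 * e + (i + j + m))%N ->
  reduces p d.
Proof.
move=> [vi vj vm vij] -> ->; have v0 := valid0.
have ij : x i * x j =G x 0 * x (i + j) by apply: quad_congr.
apply: reduces_congr (congrMr _ ij) _.
have := reduces_x0 1 (reduces_mul2 vij vm); rewrite expr1 mulrA.
by congr reduces; lia.
Qed.

Lemma reduces_carry1 i j m t p d :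
    [/\ valid i, valid j, valid m & valid t] -> (i + j = e + t)%N ->
    p = x i * x j * x m -> d = (3 * e + (i + j + m))%N ->
  reduces p d.
Proof.
move=> [vi vj vm vt] et -> ->; have [_ t1 tn] := and3P vt.
have ij : x i * x j =G cubic t.
  by apply: cubic_congr => //; rewrite /has_cubic t1 tn.
apply: reduces_congr (congrMr _ ij) _; rewrite /cubic (negPf tn).
have := reduces_x0 2 (reduces_mul2 vt vm); rewrite mulrA.
by congr reduces; lia.
Qed.

Ltac valid_lia := unfold valid in *; lia.

Lemma reduces_apery1_n2 i d : n = 2%N -> valid i ->
  d = (3 * e + (i + (3 + (e - 2))))%N -> reduces (x i * (x 3 * x (e - 2))) d.
Proof.
move=> n2 vi ->; have [lie i1 ni] := and3P vi.
have [le4i|lt4i] := leqP 5 i.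
  apply: (@reduces_carry1 i (e - 2) 3 (i - 2)); [split; valid_lia|lia|ring|lia].
by apply: (@reduces_carry0 i 3 (e - 2)); [split; valid_lia|ring|lia].
Qed.

(** For [i > 0] the usual route merges [i] with [e - 1]; it fails if [i - 1] is
    not an index, that is for [i = 2] and [i = n + 1]. *)
Lemma reduces_apery1 i d : n != 2%N -> valid i ->
  d = (3 * e + (i + (2 + (e - 1))))%N -> reduces (x i * (x 2 * x (e - 1))) d.
Proof.
move=> n2 vi ->; have [lie i1 ni] := and3P vi.
have [vi1|vi1] := boolP (valid (i - 1) && (0 < i)%N).
  apply: (@reduces_carry1 i (e - 1) 2 (i - 1)); [split; valid_lia|lia|ring|lia].
have [i0|i0] := posnP i.
  rewrite i0.
  by apply: (@reduces_carry0 0 2 (e - 1)); [split; valid_lia|ring|lia].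
have [i2|i2] := eqVneq i 2%N.
  rewrite i2; have [n4|n4] := eqVneq n 4%N; last first.
    by apply: (@reduces_carry0 2 2 (e - 1)); [split; valid_lia|ring|lia].
  have E : x 2 * x (e - 1) =G x 3 * x (e - 2).
    by apply: quad_congr; [split; valid_lia|lia].
  apply: reduces_congr (congrMl _ E) _.
  by apply: (@reduces_carry0 2 3 (e - 2)); [split; valid_lia|ring|lia].
have {i2 i0 vi1} iE : i = n.+1 by move: vi1; rewrite /valid; lia.
have [ne2|ne2] := eqVneq n (e - 2)%N.
  have E : x 2 * x (e - 1) =G x 4 * x (e - 3).
    by apply: quad_congr; [split; valid_lia|lia].
  apply: reduces_congr (congrMl _ E) _.
  by apply: (@reduces_carry1 i 4 (e - 3) 3); [split; valid_lia|lia|ring|lia].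
have [ne3|ne3] := eqVneq n (e - 3)%N.
  by apply: (@reduces_carry1 i 2 (e - 1) 0); [split; valid_lia|lia|ring|lia].
by apply: (@reduces_carry0 i 2 (e - 1)); [split; valid_lia|ring|lia].
Qed.

Lemma reduces_apery_n_n2 i d : n = 2%N -> valid i ->
  d = (3 * e + (i + (3 + (e - 1))))%N -> reduces (x i * (x 3 * x (e - 1))) d.
Proof.
move=> n2 vi ->; have [lie i1 ni] := and3P vi.
have [le4i|lt4i] := leqP 4 i.
  apply: (@reduces_carry1 i (e - 1) 3 (i - 1)); [split; valid_lia|lia|ring|lia].
by apply: (@reduces_carry0 i 3 (e - 1)); [split; valid_lia|ring|lia].
Qed.

Lemma reduces_apery_n_n3 i d : n = 3%N -> valid i ->
  d = (3 * e + (i + (4 + (e - 1))))%N -> reduces (x i * (x 4 * x (e - 1))) d.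
Proof.
move=> n3 vi ->; have [lie i1 ni] := and3P vi.
have [le4i|lt4i] := leqP 5 i.
  apply: (@reduces_carry1 i (e - 1) 4 (i - 1)); [split; valid_lia|lia|ring|lia].
by apply: (@reduces_carry0 i 4 (e - 1)); [split; valid_lia|ring|lia].
Qed.

(** The usual route merges [i] with [2]; it fails for [i >= e - 2] and for
    [i = n - 2].  The last case for [n = 4] is the cube of [x_2], where the link
    special to [n = 4] comes in. *)
Lemma reduces_apery_n i d : (4 <= n)%N -> valid i ->
  d = (3 * e + (i + (2 + (n - 2))))%N -> reduces (x i * (x 2 * x (n - 2))) d.
Proof.
move=> n4 vi ->; have [lie i1 ni] := and3P vi.
have [vi2|vi2] := boolP (valid (i + 2)).
  by apply: (@reduces_carry0 i 2 (n - 2)); [split; valid_lia|ring|lia].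
have [ie2|ie2] := eqVneq i (e - 2)%N.
  by apply: (@reduces_carry1 i 2 (n - 2) 0); [split; valid_lia|lia|ring|lia].
have [ie1|ie1] := eqVneq i (e - 1)%N.
  have [n4E|n5] := eqVneq n 4%N; last first.
    apply: (@reduces_carry1 i (n - 2) 2 (n - 3)); [split; valid_lia|lia|ring|].
    by lia.
  have -> : (n - 2 = 2)%N by lia.
  rewrite ie1 mulrC -mulrA; apply: reduces_apery1; [lia|valid_lia|lia].
have {vi2} iE : i = (n - 2)%N by move: vi2; rewrite /valid; lia.
have [n4E|n5] := eqVneq n 4%N.
  have -> : (n - 2 = 2)%N by lia.
  have -> : i = 2%N by lia.
  have E : x 2 * (x 2 * x 2) =G x 7 * x (e - 1).
    rewrite -[x 2 * (x 2 * x 2)]/(x 2 ^+ 3).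
    exact/link_congr/link_cube.
  apply: reduces_congr E _.
  have := @reduces_mul2 7 (e - 1).
  by rewrite (_ : 2 * e + _ = 3 * e + (2 + (2 + 2)))%N; [apply; valid_lia|lia].
have E : x 2 * x (n - 2) =G x 3 * x (n - 3).
  by apply: quad_congr; [split; valid_lia|lia].
apply: reduces_congr (congrMl _ E) _.
by apply: (@reduces_carry0 i 3 (n - 3)); [split; valid_lia|ring|lia].
Qed.

Lemma reduces_step i p d :
  valid i -> reduces p d -> reduces (x i * p) (e + i + d).
Proof.
move=> vi [qd pE]; have e0 : (0 < e)%N by lia.
apply: reduces_congr (congrMl _ pE) _; rewrite /normal_form mulrCA.
set q := (d %/ e)%N in qd *; set r := (d %% e)%N in qd *.
have ltr : (r < e)%N by rewrite ltn_mod.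
suff : reduces (x i * apery r) (e + i + (apery_quo r * e + r)).
  move=> /(reduces_x0 (q - apery_quo r)); congr reduces.
  rewrite [in RHS](divn_eq d e) -/q -/r -{2}(subnK qd) mulnDl; lia.
have [->|r0] := eqVneq r 0%N.
  rewrite /apery mulr1 /apery_quo /=; have [_ i1 ni] := and3P vi.
  have [->|i0] := eqVneq i 0%N.
    apply: (@reducesI 1 0) => //; try lia.
    by rewrite /apery mulr1; apply: congr_refl.
  apply: (@reducesI 1 i); rewrite ?aperyE ?apery_quoE //; try lia.
    by have [] := and3P vi.
  by rewrite subnn mul1r; apply: congr_refl.
have [->|r1] := eqVneq r 1%N.
  rewrite apery_1 apery_quo_1; case: eqP => [n2|/eqP n2].
    by apply: reduces_apery1_n2 => //; lia.
  by apply: reduces_apery1 => //; lia.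
have [->|rn] := eqVneq r n; last first.
  have vr : valid r by rewrite /valid ltr r1 rn.
  rewrite aperyE // apery_quoE //.
  by have := reduces_mul2 vi vr; congr reduces; lia.
rewrite apery_n apery_quo_n; case: eqP => [n2|n2].
  by rewrite ifT; [apply: reduces_apery_n_n2 => //; lia|lia].
case: eqP => [n3|n3].
  by rewrite ifT; [apply: reduces_apery_n_n3 => //; lia|lia].
by rewrite ifN; [apply: reduces_apery_n => //; lia|lia].
Qed.

Lemma reducesX (m : 'X_{1..N}) : reduces ('X_[m] : R) (wdeg m).
Proof.
have [D] := ubnP (mdeg m); elim: D m => // D IHD m ltm.
have [m0|m0] := eqVneq m 0%MM.
  rewrite m0 mpolyX0 (_ : wdeg 0%MM = 0%N); last first.
    by rewrite /wdeg big1 // => j _; rewrite mnm0E.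
  apply: (@reducesI 0 0) => //; first by lia.
  by rewrite /apery mulr1; apply: congr_refl.
have [j mj] : exists j, (0 < m j)%N.
  apply/existsP; apply: contraNT m0; rewrite negb_exists => /forallP m_eq0.
  by apply/eqP/mnmP => j; rewrite mnm0E; apply/eqP; rewrite -leqn0 leqNgt.
have mE : m = (U_(j) + (m - U_(j)))%MM.
  rewrite addmC submK //; apply/mnm_lepP => i.
  by rewrite mnm1E; case: eqP => // <-.
move: ltm; rewrite mE mdegD mdeg1 => ltm.
rewrite mpolyXD wdegD wdegU -xvar_idx; apply: reduces_step.
  exact: idx_valid.
exact: IHD.
Qed.

(** * The defining ideal is generated *)

Lemma phi_pair_mon s a : pair s a -> phi (pair_mon s a) = 'X^(2 * e + s).
Proof.
case/and3P=> lea va va'; rewrite phiM !phi_xvar // -exprD; congr ('X^_); lia.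
Qed.

Lemma phi_cubic t : has_cubic t -> (t < e)%N -> phi (cubic t) = 'X^(3 * e + t).
Proof.
rewrite /has_cubic /cubic => ct lte; have v0 := valid0.
have [tn|tn] := eqVneq t n.
  rewrite !phiM !phi_xvar -?exprD //; try valid_lia.
  by congr ('X^_); lia.
rewrite expr2 !phiM !phi_xvar -?exprD //; try valid_lia.
by congr ('X^_); lia.
Qed.

Lemma phi_link p : link p -> phi p = 0.
Proof.
case=> [s a b sa sb _ _|t b ct etb _|n4].
- by rewrite phiM phiB !phi_pair_mon // subrr mulr0.
- rewrite phiB (phi_pair_mon etb) phi_cubic //; last first.
    by move: etb; rewrite /pair; valid_lia.
  by rewrite (_ : 3 * e + t = 2 * e + (e + t))%N ?subrr //; lia.
rewrite phiB !exprS expr0 mulr1 !phiM !phi_xvar -?exprD; try valid_lia.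
apply/eqP; rewrite subr_eq0; apply/eqP; congr ('X^_); lia.
Qed.

Lemma congr_normal_form (p : R) :
  p =G \sum_(m <- msupp p) (p@_m)%:MP * normal_form (wdeg m).
Proof.
rewrite {1}[p]mpolyE; apply: congr_sum => m _.
by rewrite -mul_mpolyC; apply: congrMl; case: (reducesX m).
Qed.

(** Collect the terms by degree: the coefficient of [normal_form i] is that of
    ['X^i] in [phi p]. *)
Lemma sum_normal_form (p : R) : phi p = 0 ->
  \sum_(m <- msupp p) (p@_m)%:MP * normal_form (wdeg m) = 0 :> R.
Proof.
move=> p0; pose D := (\max_(m <- msupp p) wdeg m).+1.
transitivity (\sum_(m <- msupp p) \sum_(i < D)
    (((p@_m)%:P * 'X^(wdeg m))`_i)%:MP * normal_form i : R).
  rewrite big_seq [RHS]big_seq; apply: eq_bigr => m mp.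
  have ltD : (wdeg m < D)%N.
    by rewrite ltnS; exact: (@leq_bigmax_seq _ (msupp p) xpredT wdeg m).
  rewrite (bigD1 (Ordinal ltD)) //= big1 ?addr0 => [|i ni].
    by rewrite coefCM coefXn eqxx mulr1.
  have {}ni : (i == wdeg m :> nat) = false := negPf ni.
  by rewrite coefCM coefXn ni mulr0 mpolyC0 mul0r.
rewrite exchange_big big1 // => i _; rewrite -mulr_suml -raddf_sum -coef_sum.
by rewrite -phiE p0 coef0 raddf0 mul0r.
Qed.

Lemma ideal_span_G : ideal_span G = I_S k e 1 n.
Proof.
apply/seteqP; split=> [|p p0].
  apply: ideal_span_min => [|p q p0 q0|p q q0|p /G_linkE/phi_link //].
  - exact: phi0.
  - by rewrite /I_S /= phiD p0 q0 addr0.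
  - by rewrite /I_S /= phiM q0 mulr0.
have := congr_normal_form p.
by rewrite sum_normal_form // /congr_mod subr0.
Qed.

(** * Indispensability of the generators *)

(** The bound [4] on the number of factors makes the range of the sum finite;
    the monomials that matter have two or three factors. *)
Definition msum (C : pred 'X_{1..N}) (p : R) : k :=
  \sum_(m : 'X_{1..N < 4} | C m) p@_m.

Fact msum_is_additive C : additive (msum C).
Proof.
move=> p q; rewrite /msum -sumrB.
by apply: eq_bigr => m _; rewrite mcoeffB.
Qed.

HB.instance Definition _ C :=
  GRing.isAdditive.Build R k (msum C) (msum_is_additive C).

Section Separation.
Variables (C : pred 'X_{1..N}) (C_deg : forall m, C m -> (mdeg m < 4)%N).

Lemma msumX m : msum C ('X_[m] : R) = (C m)%:R.
Proof.
rewrite /msum; case: (boolP (C m)) => [Cm|Cm].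
  rewrite (bigD1 (BMultinom (C_deg Cm))) //= mcoeffX eqxx.
  rewrite big1 ?addr0 // => i /andP[_ ni].
  by rewrite mcoeffX eq_sym (negPf ni : (bmnm i == m) = false).
rewrite big1 // => i Ci; rewrite mcoeffX.
by case: eqP => // mi; rewrite mi Ci in Cm.
Qed.

Lemma msum_mul_binomial u v (p : R) : (forall m, C (m + u)%MM = C (m + v)%MM) ->
  msum C (p * ('X_[u] - 'X_[v])) = 0.
Proof.
move=> Cuv; rewrite [p]mpolyE mulr_suml raddf_sum big1 // => m _ /=.
rewrite -mul_mpolyC -mulrA mulrBr -!mpolyXD.
have -> (c : k) (q : R) : msum C (c%:MP * q) = c * msum C q.
  by rewrite /msum mulr_sumr; apply: eq_bigr => i _; rewrite mcoeffCM.
by rewrite raddfB /= !msumX Cuv subrr mulr0.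
Qed.

End Separation.

(** The monomials of degree [2 e + s] that come before the pair [b]: all
    products of three variables, and the pairs with a smaller index. *)
Definition cut s b (m : 'X_{1..N}) :=
  (wdeg m == 2 * e + s)%N &&
  ((3 <= mdeg m)%N || [exists j, (idx j < b)%N && (0 < m j)%N]).

Lemma mdeg_le_wdeg (m : 'X_{1..N}) : (mdeg m * e <= wdeg m)%N.
Proof.
rewrite mdegE /wdeg big_distrl /=; apply: leq_sum => j _.
by rewrite leq_mul2l leq_addr orbT.
Qed.

Lemma cut_deg s b m : (s < 2 * e)%N -> cut s b m -> (mdeg m < 4)%N.
Proof.
move=> lts /andP[/eqP wm _]; have := mdeg_le_wdeg m; rewrite wm => le_m.
rewrite ltnNge; apply/negP => le4m; have := leq_mul le4m (leqnn e); lia.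
Qed.

(** Both monomials have at least three factors. *)
Lemma cut_shift s b m u v : m != 0%MM -> wdeg u = wdeg v ->
    (2 <= mdeg u)%N -> (2 <= mdeg v)%N ->
  cut s b (m + u) = cut s b (m + v).
Proof.
rewrite -mdeg_eq0 /cut !wdegD !mdegD => m0 -> u2 v2.
by have [-> ->] : (3 <= mdeg m + mdeg u)%N /\ (3 <= mdeg m + mdeg v)%N by lia.
Qed.

Lemma xvarX i : valid i -> exists2 j, idx j = i & x i = 'X_j :> R.
Proof. by move=> /idx_onto[j <-]; exists j; rewrite ?xvar_idx. Qed.

(** The exponent vector [u] of [pair_mon s a], with the properties of it that
    decide membership in [cut]. *)
Definition pair_mnm s a (u : 'X_{1..N}) :=
  [/\ pair s a, pair_mon s a = 'X_[u] :> R, mdeg u = 2, wdeg u = (2 * e + s)%N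
  & forall j, (0 < u j)%N = (idx j == a) || (idx j == s - a)%N].

Lemma pair_monX s a : pair s a -> exists u, pair_mnm s a u.
Proof.
move=> sa; case/and3P: (sa) => lea /xvarX[j ja xj] /xvarX[l lsa xl].
exists (U_(j) + U_(l))%MM; rewrite /pair_mnm mdegD !mdeg1 wdegD !wdegU.
rewrite /pair_mon xj xl -mpolyXD; split=> //; first by lia.
move=> i; rewrite mnmDE !mnm1E addn_gt0 !lt0b -lsa -ja.
by rewrite !(inj_eq idx_inj) ![_ == i]eq_sym.
Qed.

Lemma cubicX t : has_cubic t -> (t < e)%N -> exists u : 'X_{1..N},
  [/\ cubic t = 'X_[u], mdeg u = 3, wdeg u = (3 * e + t)%N
    & exists2 j, idx j = 0%N & (0 < u j)%N].
Proof.
rewrite /has_cubic /cubic => ct lte.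
have [j j0 xj] := xvarX valid0.
have [tn|tn] := eqVneq t n.
  have [|i i2 xi] := @xvarX 2; first by valid_lia.
  have [|l ln xl] := @xvarX (n - 2); first by valid_lia.
  exists (U_(j) + U_(i) + U_(l))%MM.
  rewrite !mdegD !mdeg1 !wdegD !wdegU xi xj xl -!mpolyXD.
  split=> //; first by lia.
  by exists j; rewrite // !mnmDE !mnm1E eqxx.
have [|l lt xl] := @xvarX t; first by valid_lia.
exists (U_(j) + U_(j) + U_(l))%MM.
rewrite !mdegD !mdeg1 !wdegD !wdegU xj xl expr2 -!mpolyXD.
split=> //; first by lia.
by exists j; rewrite // !mnmDE !mnm1E eqxx.
Qed.

Lemma cut_pair s b s' a u : pair_mnm s' a u ->
  cut s b u = (s' == s) && (a < b)%N.
Proof.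
case=> sa _ u2 wu supp; have /and3P[lea va va'] := sa.
rewrite /cut u2 wu eqn_add2l; congr (_ && _).
apply/existsP/idP => [[i]|ltab]; first by rewrite supp; lia.
by have [j ja] := idx_onto va; exists j; rewrite supp ja eqxx ltab.
Qed.

Definition only_x2 (u : 'X_{1..N}) :=
  [forall j, (0 < u j)%N ==> (idx j == 2%N)].

Lemma only_x2D m u : only_x2 (m + u)%MM -> only_x2 u.
Proof.
move=> /forallP mu; apply/forallP => j; apply/implyP => uj.
by apply: (implyP (mu j)); rewrite mnmDE addn_gt0 uj orbT.
Qed.

Lemma only_x2_pair s a u : pair_mnm s a u -> only_x2 u -> a = 2%N /\ s = 4%N.
Proof.
case=> /and3P[lea va va'] _ _ _ supp /forallP u2.
have [j ja] := idx_onto va; have [l la] := idx_onto va'.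
have := u2 j; have := u2 l; rewrite !supp ja la !eqxx orbT /=.
by move=> /eqP sa2 /eqP a2; lia.
Qed.

(** The links as differences of monomials.  The cube [x_2 ^ 3] is treated as a
    product of three variables like the others: the pair that it is linked to is
    the first one of its degree, too. *)
Variant link_view (h : R) : Prop :=
| PairView s a b u v of
    pair_mnm s a u & pair_mnm s b v & (a < b)%N & gap_pairs s a b &
    h = (-1) ^+ flipped a b * ('X_[u] - 'X_[v])
| TripleView t b u v of
    mdeg u = 3 & wdeg u = (3 * e + t)%N & pair_mnm (e + t) b v &
    first_pair (e + t) b & h = 'X_[u] - 'X_[v] &
    (h = cubic t - pair_mon (e + t) b /\ ~~ only_x2 u) \/
    [/\ n = 4%N, t = 6%N, h = x 2 ^+ 3 - x 7 * x (e - 1) & only_x2 u].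

Lemma link_viewP h : link h -> link_view h.
Proof.
case=> [s a b sa sb ltab gap|t b ct etb firstb|n4].
- have [u ua] := pair_monX sa; have [v vb] := pair_monX sb.
  apply: (PairView ua vb ltab gap).
  by case: ua => _ -> _ _ _; case: vb => _ -> _ _ _.
- have [v vb] := pair_monX etb.
  have lte : (t < e)%N by move: etb; rewrite /pair; valid_lia.
  have [u [uE u3 wu [j j0 uj]]] := cubicX ct lte.
  apply: (TripleView u3 wu vb firstb).
    by case: vb => _ -> _ _ _; rewrite uE.
  left; split=> //; apply/forallPn; exists j.
  by rewrite j0 uj.
have etb : pair (e + 6) 7 by rewrite /pair; valid_lia.
have [v vb] := pair_monX etb; have [|j j2 xj] := @xvarX 2; first by valid_lia.
have e1 : (e + 6 - 7 = e - 1)%N by lia.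
apply: (@TripleView _ 6 7 (U_(j) *+ 3)%MM v) => //.
- by rewrite mdegMn mdeg1.
- rewrite !mulmS mulm0n !wdegD wdegU j2 /wdeg big1 => [|i _]; last first.
    by rewrite mnm0E.
  by lia.
- by move=> c ltc; rewrite /pair; valid_lia.
- case: vb => _ <- _ _ _; rewrite /pair_mon e1 xj mpolyXn; reflexivity.
right; split=> //; apply/forallP => i; apply/implyP.
by rewrite mulmnE mnm1E; case: eqP => // <- _; rewrite j2.
Qed.

Lemma cut_pair_link s b s' a' b' u v m :
    pair_mnm s' a' u -> pair_mnm s' b' v -> (a' < b')%N ->
    ~~ [&& s' == s, a' < b & b <= b']%N ->
  cut s b (m + u) = cut s b (m + v).
Proof.
move=> ua vb ltab; have [->|m0] := eqVneq m 0%MM.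
  by rewrite !add0m (cut_pair _ _ ua) (cut_pair _ _ vb); lia.
case: ua vb => _ _ u2 wu _ [_ _ v2 wv _] _.
by apply: cut_shift => //; rewrite ?u2 ?v2 // wu wv.
Qed.

Lemma cut_triple_link s b t b' u v m :
    mdeg u = 3 -> wdeg u = (3 * e + t)%N -> pair_mnm (e + t) b' v ->
    (s = e + t -> b' < b)%N ->
  cut s b (m + u) = cut s b (m + v).
Proof.
move=> u3 wu vb lt_b; have [->|m0] := eqVneq m 0%MM.
  rewrite !add0m (cut_pair _ _ vb) /cut u3 wu /= andbT.
  by lia.
case: vb => _ _ v2 wv _.
by apply: cut_shift => //; rewrite ?u3 ?v2 // wu wv; lia.
Qed.

Lemma pair_link_not_x2 s a b u v m : n = 4%N ->
    pair_mnm s a u -> pair_mnm s b v -> (a < b)%N ->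
  only_x2 (m + u) = false /\ only_x2 (m + v) = false.
Proof.
move=> n4 ua vb ltab.
split; apply/negP => /only_x2D; [case/(only_x2_pair ua)|case/(only_x2_pair vb)].
  by move=> a2 s4; case: vb => /and3P[leb _ _] _ _ _ _; lia.
move=> b2 s4; case: ua => /and3P[_]; rewrite /valid => va va' _ _ _ _; lia.
Qed.

Lemma pair_not_x2 t b v m : pair_mnm (e + t) b v -> only_x2 (m + v) = false.
Proof. by move=> vb; apply/negP => /only_x2D /(only_x2_pair vb); lia. Qed.

Definition separated (g : R) := exists2 l : {additive R -> k}, l g != 0 &
  forall h p, G h -> h != g -> l (p * h) = 0.

Lemma separated_pair s a b u v :
    pair_mnm s a u -> pair_mnm s b v -> (a < b)%N -> gap_pairs s a b ->
  separated ((-1) ^+ flipped a b * ('X_[u] - 'X_[v])).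
Proof.
move=> ua vb ltab gap; have [sb _ _ _ _] := vb; have [sa _ _ _ _] := ua.
have lts : (s < 2 * e)%N by move: sb; rewrite /pair; valid_lia.
have degC := fun m => @cut_deg s b m lts.
exists (msum (cut s b) : {additive R -> k}) => /=.
  rewrite raddfMsign raddfB /= !msumX // (cut_pair _ _ ua) (cut_pair _ _ vb).
  by rewrite eqxx ltab ltnn subr0 mulr1 signr_eq0.
move=> h p /G_linkE/link_viewP.
case=> [s' a' b' u' v' ua' vb' ltab' gap' ->
       |t b' u' v' u3 wu vb' firstb -> _] neq.
  rewrite mulrA; apply: msum_mul_binomial => // m.
  apply: (cut_pair_link _ ua' vb' ltab').
  apply/negP => /and3P[/eqP ss lta'b lebb'].
  case/eqP: neq; rewrite ss in ua' vb' gap'.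
  have [sa' _ _ _ _] := ua'.
  have bb : b' = b.
    apply/eqP; rewrite eqn_leq lebb' andbT leqNgt; apply/negP => ltbb'.
    by have := gap' b; rewrite lta'b ltbb' sb => /(_ isT).
  have aa : a' = a.
    case: (ltngtP a' a) => // [lta'a|ltaa'].
      by have := gap' a; rewrite lta'a bb ltab sa => /(_ isT).
    by have := gap a'; rewrite ltaa' lta'b sa' => /(_ isT).
  move: ua' vb'; rewrite aa bb; case: ua vb => _ <- _ _ _ [_ <- _ _ _].
  by case=> _ <- _ _ _ [_ <- _ _ _].
apply: msum_mul_binomial => // m; apply: (cut_triple_link _ u3 wu vb') => st.
rewrite st in sa; apply: leq_ltn_trans ltab; rewrite leqNgt.
apply/negP => ltab'.
by have := firstb a ltab'; rewrite sa.
Qed.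

(** In degree [3 e + 6] with [n = 4] two links end in the same pair.  The cube
    of [x_2] is therefore removed from the cut; this does not spoil the vanishing
    on multiples of other links, none of whose terms divides [x_2 ^ 3]. *)
Lemma separated_cubic t b u v :
    mdeg u = 3 -> wdeg u = (3 * e + t)%N -> pair_mnm (e + t) b v ->
    first_pair (e + t) b -> ~~ only_x2 u ->
    'X_[u] - 'X_[v] = cubic t - pair_mon (e + t) b ->
  separated ('X_[u] - 'X_[v]).
Proof.
move=> u3 wu vb firstb u2 gE; have [etb _ _ _ _] := vb.
have lts : (e + t < 2 * e)%N by move: etb; rewrite /pair; valid_lia.
pose C (m : 'X_{1..N}) :=
  cut (e + t) b m && ~~ [&& n == 4%N, mdeg m == 3 & only_x2 m].
have degC m : C m -> (mdeg m < 4)%N by case/andP=> /(cut_deg lts).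
exists (msum C : {additive R -> k}) => /=.
  rewrite raddfB /= !msumX // /C (cut_pair _ _ vb) ltnn (negPf u2).
  rewrite !andbF /= andbT.
  have wE : (3 * e + t == 2 * e + (e + t))%N by lia.
  by rewrite /cut wu u3 wE /= subr0 oner_neq0.
move=> h p /G_linkE/link_viewP.
case=> [s' a' b' u' v' ua' vb' ltab' gap' ->
       |t' b' u' v' u3' wu' vb' firstb' ->].
  move=> _; rewrite mulrA; apply: msum_mul_binomial => // m; rewrite /C.
  congr (_ && ~~ _).
    apply: (cut_pair_link _ ua' vb' ltab').
    apply/negP => /and3P[/eqP ss lta'b _].
    have [sa' _ _ _ _] := ua'; rewrite ss in sa'.
    by have := firstb a' lta'b; rewrite sa'.
  case: eqP => //= n4.
  by have [-> ->] := pair_link_not_x2 m n4 ua' vb' ltab'; rewrite !andbF.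
have bb : t' = t -> b' = b.
  move=> tt; rewrite tt in vb' firstb'; have [etb' _ _ _ _] := vb'.
  exact: first_pair_unique etb' etb firstb' firstb.
case=> [[hE u2'] neq|[n4 t6 _ u2'] _].
all: apply: msum_mul_binomial => // m; rewrite /C.
  congr (_ && ~~ _).
    apply: (cut_triple_link _ u3' wu' vb') => tt; have {}tt : t' = t by lia.
    by case/eqP: neq; rewrite gE hE tt (bb tt).
  rewrite (pair_not_x2 _ vb') !andbF (_ : only_x2 _ = false) ?andbF //.
  by apply/negP => /only_x2D; apply/negP.
rewrite (pair_not_x2 _ vb') !andbF andbT.
have [m0|m0] := eqVneq m 0%MM.
  rewrite m0 !add0m u2' u3' n4 !andbF (cut_pair _ _ vb').
  by case: eqP => //= tt; rewrite bb ?ltnn //; lia.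
have -> : (mdeg (m + u')%MM == 3) = false.
  by rewrite mdegD u3'; move: m0; rewrite -mdeg_eq0; lia.
rewrite andbF andbT; case: vb' => _ _ v2 wv _.
by apply: cut_shift => //; rewrite ?u3' ?v2 // wu' wv; lia.
Qed.

Lemma separated_cube b u v : n = 4%N -> mdeg u = 3 -> pair_mnm (e + 6) b v ->
    only_x2 u -> 'X_[u] - 'X_[v] = x 2 ^+ 3 - x 7 * x (e - 1) ->
  separated ('X_[u] - 'X_[v]).
Proof.
move=> n4 u3 vb u2 gE.
pose C (m : 'X_{1..N}) := (mdeg m == 3) && only_x2 m.
have degC m : C m -> (mdeg m < 4)%N by case/andP=> /eqP->.
exists (msum C : {additive R -> k}) => /=.
  have [_ _ v2 _ _] := vb.
  by rewrite raddfB /= !msumX // /C u3 v2 u2 subr0 oner_neq0.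
move=> h p /G_linkE/link_viewP.
case=> [s' a' b' u' v' ua' vb' ltab' _ ->|t' b' u' v' u3' _ vb' _ ->].
  move=> _; rewrite mulrA; apply: msum_mul_binomial => // m; rewrite /C.
  by have [-> ->] := pair_link_not_x2 m n4 ua' vb' ltab'; rewrite !andbF.
case=> [[_ u2'] _|[_ _ -> _]]; last by rewrite gE eqxx.
apply: msum_mul_binomial => // m; rewrite /C (pair_not_x2 _ vb') andbF.
by apply/negbTE/nandP; right; apply/negP => /only_x2D; apply/negP.
Qed.

Lemma G_separated g : G g -> separated g.
Proof.
move=> /G_linkE/link_viewP.
case=> [s a b u v ua vb ltab gap ->|t b u v u3 wu vb firstb gE].
  exact: separated_pair ua vb ltab gap.
rewrite gE; case=> [[hE u2]|[n4 t6 hE u2]].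
  exact: separated_cubic u3 wu vb firstb u2 hE.
by rewrite t6 in vb; apply: separated_cube n4 u3 vb u2 hE.
Qed.

Lemma minimal_generating_set_G : minimal_generating_set (I_S k e 1 n) G.
Proof. exact: minimal_generating_setP ideal_span_G G_separated. Qed.

End Ring.

Theorem theorem3p1 (K : closedFieldType) (char0 : [pchar K] =i pred0)
    (e n : nat) (he : (10 <= e)%N) (hn : (2 <= n <= e - 2)%N) :
  minimal_generating_set (I_S K e 1 n) (G_S K e n).
Proof. exact: minimal_generating_set_G he hn. Qed.
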